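(* Let $G$ be a bipartite graph endowed with a weak nested ear decomposition. Then the number of even ears (ears of even length) and pendant edges is the same for all weak nested ear decompositions of $G$; that is, if $\mathcal{P}_0,\dots,\mathcal{P}_r$ and $\mathcal{Q}_0,\dots,\mathcal{Q}_s$ are weak nested ear decompositions of $G$, then the number of even ears plus the number of pendant edges of the first decomposition equals the corresponding number for the second.
   Context: Graphs are simple (finite, undirected, no loops, no multiple edges) and have no isolated vertices. $E_G$ denotes the edge set of $G$. Paths: a path $\mathcal{P}\subset G$ is a subgraph with an ordering of its vertices $v_0,v_1,\dots,v_\ell$, $\ell>0$, such that $v_1,\dots,v_\ell$ are distinct, $v_0,\dots,v_{\ell-1}$ are distinct, and its edge set consists of the $\ell$ distinct edges $\{v_i,v_{i+1}\}$, $0\le i\le \ell-1$; $v_0=v_\ell$ is allowed (then $\mathcal P$ is a cycle, $\ell\ge 3$). The inner vertices are $v_1,\dots,v_{\ell-1}$; the end-vertices are $v_0$ and $v_\ell$; the length is $\ell(\mathcal{P})=\ell$. Weak nested ear decomposition of $G$: a collection of subgraphs $\mathcal{P}_0,\dots,\mathcal{P}_r$ of $G$, $r>0$, whose edge sets form a partition of $E_G$ (the edge set of $\mathcal P_0$ being empty), such that $\mathcal{P}_0$ is a vertex and, for every $1\le i\le r$, $\mathcal{P}_i$ is a path such that either (1) both end-vertices of $\mathcal{P}_i$ belong to some $\mathcal{P}_j$ with $j<i$, and none of its inner vertices belongs to $\mathcal{P}_0\cup\cdots\cup\mathcal{P}_{i-1}$ (then $\mathcal{P}_i$ is called an ear of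 the decomposition), or (2) $\ell(\mathcal{P}_i)=1$ and only one of the end-vertices of $\mathcal{P}_i$ belongs to $\mathcal{P}_0\cup\cdots\cup\mathcal{P}_{i-1}$ (then $\mathcal{P}_i$ is called a pendant edge of the decomposition); and such that the following nesting condition holds. If $\mathcal{P}_i$ has both its end-vertices in $\mathcal{P}_j$, $j<i$, then $\mathcal{P}_i$ is said to be nested in $\mathcal{P}_j$, and its nest interval in $\mathcal{P}_j$ is the subpath of $\mathcal{P}_j$ determined by the end-vertices of $\mathcal{P}_i$ (the segment between them in the ordering of $\mathcal{P}_j$) if they are distinct, or that single vertex if they coincide. (If $\mathcal{P}_j$ has $v_0=v_\ell$ and this vertex is one of two distinct end-vertices of $\mathcal{P}_i$, a choice of one of the two segments is fixed.) If $\mathcal{P}_i$ is a pendant edge, its nest interval is its end-vertex lying in a previous $\mathcal{P}_j$. Nesting condition: if two paths $\mathcal{P}_i$ and $\mathcal{P}_l$ are nested in $\mathcal{P}_j$, with $j<i,l$, then the corresponding nest intervals in $\mathcal{P}_j$ have disjoint edge sets or one edge set is contained in the other. *)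

(* Defs.v *)
From mathcomp Require Import all_boot.
Set Implicit Arguments.
Unset Strict Implicit.
Unset Printing Implicit Defensive.

(* A simple graph on the vertex set T is its adjacency relation e. *)

Definition simple_graph (T : finType) (e : rel T) : Prop :=
  symmetric e /\ irreflexive e.

Definition no_isolated (T : finType) (e : rel T) : Prop :=
  forall x : T, exists y : T, e x y.

Definition bipartite (T : finType) (e : rel T) : Prop :=
  exists A : {set T}, forall x y : T, e x y -> (x \in A) != (y \in A).

Definition edge_set (T : finType) (e : rel T) : {set {set T}} :=
  [set [set x; y] | x in T, y in T & e x y].

(* The vertex ordering v_0, v_1, ..., v_l is the pair (v_0, [:: v_1; ...; v_l]);
   a single vertex v is (v, [::]). *)

Definition vorder (T : finType) : Type := (T * seq T)%type.

Section VertexOrder.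
Variables (T : finType) (p : vorder T).

Definition vertices : seq T := p.1 :: p.2.
Definition source : T := p.1.
Definition target : T := last p.1 p.2.
Definition inner : seq T := behead (belast p.1 p.2).
Definition len : nat := size p.2.
Definition vertex (k : nat) : T := nth p.1 vertices k.

(* [:: {v_0, v_1}; ...; {v_(l-1), v_l}] *)
Definition edges : seq {set T} := pairmap (fun x y => [set x; y]) p.1 p.2.

(* edges of the segment v_a, ..., v_b, for a <= b <= l *)
Definition segment_edges (a b : nat) : {set {set T}} :=
  [set E in take (b - a) (drop a edges)].

End VertexOrder.

(* The case v_0 = v_l is allowed; distinctness of the edges then forces
   l >= 3. *)
Definition is_path (T : finType) (e : rel T) (p : vorder T) : bool :=
  [&& 0 < len p, path e p.1 p.2, uniq p.2, uniq (belast p.1 p.2)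
    & uniq (edges p)].

Section EarDecomposition.
Variables (T : finType) (r : nat) (P : 'I_r.+1 -> vorder T).

Definition in_previous (i : 'I_r.+1) (v : T) : bool :=
  [exists j : 'I_r.+1, (j < i) && (v \in vertices (P j))].

Definition ends_in (i j : 'I_r.+1) : bool :=
  (source (P i) \in vertices (P j)) && (target (P i) \in vertices (P j)).

Definition is_ear (i : 'I_r.+1) : bool :=
  [exists j : 'I_r.+1, (j < i) && ends_in i j]
  && all (fun v => ~~ in_previous i v) (inner (P i)).

Definition is_pendant (i : 'I_r.+1) : bool :=
  (len (P i) == 1)
  && (in_previous i (source (P i)) (+) in_previous i (target (P i))).

(* A pendant edge counts as nested in every earlier P j that contains its
   attaching vertex. *)
Definition nested_in (i j : 'I_r.+1) : bool :=
  (j < i) &&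
  (ends_in i j
   || is_pendant i && ((source (P i) \in vertices (P j))
                       || (target (P i) \in vertices (P j)))).

(* The segment from position a to position b of P j is a nest interval of P i
   in P j. Positions, rather than vertices, are used because the base vertex
   of a closed P j has the two positions 0 and len (P j): it is exactly when
   this vertex is one of two distinct ends of P i that two segments qualify. *)
Definition is_nest_interval (i j : 'I_r.+1) (a b : nat) : Prop :=
  [/\ a <= b, b <= len (P j)
    & if ends_in i j then
        ((vertex (P j) a = source (P i) /\ vertex (P j) b = target (P i))
         \/ (vertex (P j) a = target (P i) /\ vertex (P j) b = source (P i)))
        /\ (source (P i) = target (P i) -> a = b)
      else
        a = b /\ (vertex (P j) a = source (P i)
                  \/ vertex (P j) a = target (P i))].

(* lo i j and hi i j delimit the chosen nest interval of P i in P j. *)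
Definition nesting_condition : Prop :=
  exists lo hi : 'I_r.+1 -> 'I_r.+1 -> nat,
    (forall i j, nested_in i j -> is_nest_interval i j (lo i j) (hi i j)) /\
    (forall i l j, nested_in i j -> nested_in l j ->
       let Ei := segment_edges (P j) (lo i j) (hi i j) in
       let El := segment_edges (P j) (lo l j) (hi l j) in
       [\/ [disjoint Ei & El], Ei \subset El | El \subset Ei]).

Record weak_nested_ear_decomposition (e : rel T) : Prop := {
  wned_pos : 0 < r;
  wned_vertex : len (P ord0) = 0;
  wned_path : forall i : 'I_r.+1, 0 < i -> is_path e (P i);
  wned_cover : \bigcup_i [set E in edges (P i)] = edge_set e;
  wned_disjoint : forall i j : 'I_r.+1, i != j ->
    [disjoint edges (P i) & edges (P j)];
  wned_step : forall i : 'I_r.+1, 0 < i -> is_ear i \/ is_pendant i;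
  wned_nesting : nesting_condition
}.

Definition num_even_ears : nat :=
  #|[set i | is_ear i && ~~ odd (len (P i))]|.

Definition num_pendants : nat := #|[set i | is_pendant i]|.

End EarDecomposition.

(* Main.v *)
(** Put [b i = 1] for a pendant edge and [b i = floor (len / 2)] for an ear.
    Counting the vertices that each path adds gives
    [2 * \sum_i b i + 1 = #even ears + #pendants + #vertices], so it suffices
    that [\sum_i b i] does not depend on the decomposition. It is the maximum
    over edge sets [K] of the least size of an edge set with the same vertex
    degree parities as [K].

    The maximum is at most [\sum_i b i]: working backwards from the last path,
    if [K] uses more than half of an ear, add to it the cycle formed by the ear
    and a segment of an earlier path.

    It is attained by the set [J] of all pendant edges and every second edge of
    each ear, because every edge set [C] with even degrees meets [J] in at most
    half of its edges. Indeed, choose the last [P j] in which some path is nested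
    and an ear [P i] with shortest nest interval [I] in [P j]. Nesting forces
    [C] to contain all or none of the edges of [I], and likewise of [P i]. If [C]
    contains [P i], pass to its symmetric difference with [P i] and [I]: with
    signs -1 on [J] and +1 off [J], [P i] has weight 0 or 1 according to the
    parity of its length, and [I] has weight at most 1 in absolute value with,
    [G] being bipartite, the same parity. *)
Require Import Defs.
From mathcomp Require Import all_boot zify.
Set Implicit Arguments.
Unset Strict Implicit.
Unset Printing Implicit Defensive.

(** * Symmetric differences of finite sets *)

Section SymmetricDifference.
Variable U : finType.
Implicit Types A B : {set U}.

Definition symd A B : {set U} := [set x | (x \in A) (+) (x \in B)].

Lemma in_symd A B x : (x \in symd A B) = (x \in A) (+) (x \in B).
Proof. by rewrite inE. Qed.

Lemma symdK A B : symd (symd A B) B = A.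
Proof. by apply/setP => x; rewrite !in_symd addbK. Qed.

Lemma symd_setI A B D : symd A B :&: D = symd (A :&: D) (B :&: D).
Proof. by apply/setP => x; rewrite !inE andb_addl. Qed.

Lemma card_symd A B : #|symd A B| + (#|A :&: B|).*2 = #|A| + #|B|.
Proof.
have -> : symd A B = (A :\: B) :|: (B :\: A).
  by apply/setP => x; rewrite !inE; do 2 case: (_ \in _).
have /eqP := cardsUI (A :\: B) (B :\: A).
have -> : (A :\: B) :&: (B :\: A) = set0.
  by apply/setP => x; rewrite !inE; do 2 case: (_ \in _).
have := cardsID B A; have := cardsID A B; rewrite cards0 (setIC B A); lia.
Qed.

Lemma leq_card_symd A B : #|symd A B| <= #|A| + #|B|.
Proof. by rewrite -card_symd leq_addr. Qed.

Lemma odd_card_symd A B : odd #|symd A B| = odd #|A| (+) odd #|B|.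
Proof. by rewrite -oddD -card_symd oddD odd_double addbF. Qed.

End SymmetricDifference.

(** * Degree parities of edge sets *)

Section DegreeParity.
Variable T : finType.
Implicit Types (C D : {set {set T}}) (v x y : T).

Definition odd_degree C v : bool := odd #|[set E in C | v \in E]|.

Lemma odd_degree_symd C D v :
  odd_degree (symd C D) v = odd_degree C v (+) odd_degree D v.
Proof.
rewrite /odd_degree -odd_card_symd; congr (odd #|pred_of_set _|).
by apply/setP => E; rewrite !inE andb_addl.
Qed.

End DegreeParity.

(** * Paths, their segments and positions *)

Section Path.
Variables (T : finType) (p : vorder T).

Definition edge (k : nat) : {set T} := [set vertex p k; vertex p k.+1].

Lemma size_edges : size (edges p) = len p.
Proof. by rewrite /edges size_pairmap. Qed.

Lemma nth_edges k : k < len p -> nth set0 (edges p) k = edge k.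
Proof. by move=> lt_k; rewrite (nth_pairmap p.1). Qed.

Lemma edgesP E : reflect (exists2 k, k < len p & E = edge k) (E \in edges p).
Proof.
apply: (iffP (nthP set0)); rewrite size_edges => -[k lt_k].
  by rewrite nth_edges // => <-; exists k.
by move->; exists k; rewrite ?nth_edges.
Qed.

Lemma mem_edge k : k < len p -> edge k \in edges p.
Proof. by move=> lt_k; apply/edgesP; exists k. Qed.

Lemma target_vertex : target p = vertex p (len p).
Proof. by rewrite /vertex /vertices /len -last_nth. Qed.

Lemma verticesP v :
  reflect (exists2 k, k <= len p & v = vertex p k) (v \in vertices p).
Proof.
apply: (iffP (nthP p.1)) => [[k lt_k <-]|[k le_k ->]]; first by exists k.
by exists k.
Qed.

Lemma mem_vertex k : k <= len p -> vertex p k \in vertices p.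
Proof. by move=> le_k; apply/verticesP; exists k. Qed.

Lemma mem_source : source p \in vertices p.
Proof. exact: mem_head. Qed.

Lemma mem_target : target p \in vertices p.
Proof. exact: mem_last. Qed.

Lemma edges_vertices E v : E \in edges p -> v \in E -> v \in vertices p.
Proof.
by case/edgesP=> k lt_k ->; rewrite !inE => /orP[]/eqP->; apply: mem_vertex; lia.
Qed.

Lemma belastE : belast p.1 p.2 = take (len p) (vertices p).
Proof. by rewrite /vertices lastI -cats1 take_size_cat ?size_belast. Qed.

Lemma inner_vertex k : 0 < k < len p -> vertex p k \in inner p.
Proof.
case: k => // k /= lt_k; rewrite /inner belastE.
apply/(nthP p.1); exists k; last by rewrite nth_behead nth_take.
by rewrite size_behead size_take /= ltnS leqnn; lia.
Qed.

Lemma ends_or_inner v :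
  v \in vertices p -> v \notin inner p -> v = source p \/ v = target p.
Proof.
case/verticesP=> k le_k -> not_inner; case: (posnP k) => [->|k_gt0]; first by left.
move: le_k; rewrite leq_eqVlt => /orP[/eqP->|lt_k].
  by right; rewrite target_vertex.
by rewrite inner_vertex ?k_gt0 in not_inner.
Qed.

Variable e : rel T.
(** The guard [0 < len p] lets these results apply to the single vertex [P ord0] as well. *)
Hypotheses (e_irr : irreflexive e) (p_path : 0 < len p -> is_path e p).

(** Only the two extreme positions can share a vertex: distinctness of v_1, ..., v_l settles
    [k > 0], and that of v_0, ..., v_(l-1) settles [k = 0]. *)
Lemma interior_vertex_inj m k :
  0 < m < len p -> k <= len p -> vertex p k = vertex p m -> k = m.
Proof.
case/andP=> m_gt0 lt_m le_k eq_km.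
have /and5P[_ _ uniq_tl uniq_hd _] := p_path (leq_trans m_gt0 (ltnW lt_m)).
case: k le_k eq_km => [_|k le_k] eq_km; last first.
  case: m m_gt0 lt_m eq_km => // m _ lt_m /eqP.
  by rewrite /vertex /= nth_uniq // ?(ltnW lt_m) // => /eqP->.
move: uniq_hd; rewrite belastE => /(uniqP p.1) inj; apply: inj.
- by rewrite inE size_take /= ltnS leqnn; lia.
- by rewrite inE size_take /= ltnS leqnn; lia.
by rewrite !nth_take //; lia.
Qed.

Lemma interior_edge m k :
  0 < m < len p -> k < len p -> vertex p m \in edge k -> k = m.-1 \/ k = m.
Proof.
move=> m_in lt_k; rewrite !inE => /orP[]/eqP/esym eq_km.
  by right; apply: interior_vertex_inj eq_km => //; exact: ltnW.
by left; rewrite -(interior_vertex_inj m_in lt_k eq_km).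
Qed.

Lemma uniq_edges : uniq (edges p).
Proof.
case: (posnP (len p)) => [|/p_path/and5P[]//].
by rewrite /len /edges; case: p => x [].
Qed.

Lemma edge_inj k m : k < len p -> m < len p -> edge k = edge m -> k = m.
Proof.
move=> lt_k lt_m; rewrite -!nth_edges // => /eqP.
by rewrite nth_uniq ?size_edges ?uniq_edges // => /eqP.
Qed.

Lemma adjacent_vertices k : k < len p -> e (vertex p k) (vertex p k.+1).
Proof.
move=> lt_k; have /p_path/and5P[_ /(pathP p.1) adj _ _ _] : 0 < len p by lia.
exact: adj.
Qed.

Lemma segmentE a b : b <= len p ->
  take (b - a) (drop a (edges p)) = [seq edge k | k <- index_iota a b].
Proof.
move=> le_b; apply: (@eq_from_nth _ set0).
  rewrite size_map size_iota size_take_min size_drop size_edges; lia.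
move=> k; rewrite size_take_min size_drop size_edges => lt_k.
have {}lt_k : k < b - a by lia.
rewrite nth_take // nth_drop nth_edges; last by lia.
by rewrite (nth_map 0) ?size_iota // nth_iota.
Qed.

Lemma mem_segment a b k : b <= len p -> k < len p ->
  (edge k \in segment_edges p a b) = (a <= k < b).
Proof.
move=> le_b lt_k; rewrite inE segmentE //; apply/mapP/idP => [[m]|in_k].
  rewrite mem_index_iota => in_m /edge_inj -> //; lia.
by exists k => //; rewrite mem_index_iota.
Qed.

Lemma card_segment (f : pred {set T}) a b : b <= len p ->
  #|[set E in segment_edges p a b | f E]| = \sum_(a <= k < b) f (edge k).
Proof.
move=> le_b; set s := take (b - a) (drop a (edges p)).
have uniq_s : uniq s by rewrite take_uniq // drop_uniq // uniq_edges.
have -> : [set E in segment_edges p a b | f E] = [set E in [seq E <- s | f E]].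
  by apply/setP => E; rewrite !inE mem_filter andbC.
rewrite cardsE (card_uniqP (filter_uniq _ uniq_s)) size_filter -sum1_count.
by rewrite big_mkcond /s segmentE // big_map; apply: eq_bigr => k _; case: (f _).
Qed.

Lemma segment_full : segment_edges p 0 (len p) = [set E in edges p].
Proof. by rewrite /segment_edges drop0 subn0 -size_edges take_size. Qed.

Lemma segment_sub a b : {subset segment_edges p a b <= edges p}.
Proof. by move=> E; rewrite inE => /mem_take/mem_drop. Qed.

Lemma card_segment_all a b : b <= len p -> #|segment_edges p a b| = b - a.
Proof.
move=> le_b; have := card_segment predT a le_b; rewrite sum_nat_const_nat muln1.
by move<-; congr #|pred_of_set _|; apply/setP => E; rewrite !inE andbT.
Qed.

(** Each edge flips the parity at its two distinct ends, so all contributions cancel except those of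
    the ends of the segment; a closed segment leaves none. *)
Lemma odd_degree_segment a b v : a <= b -> b <= len p ->
  odd_degree (segment_edges p a b) v = (v == vertex p a) (+) (v == vertex p b).
Proof.
move=> le_ab le_b; rewrite /odd_degree (@card_segment (fun E => v \in E)) //.
elim: b le_ab le_b => [|b IHb] le_ab le_b.
  by rewrite big_geq // (eqP (_ : a == 0)) ?addbb // -leqn0.
move: le_ab; rewrite leq_eqVlt => /orP[/eqP->|le_ab]; first by rewrite big_geq ?addbb.
rewrite big_nat_recr //= oddD oddb IHb ?(ltnW le_b) // !inE.
have neq : vertex p b != vertex p b.+1.
  by apply: contraTneq (adjacent_vertices le_b) => <-; rewrite e_irr.
case: (v =P vertex p b) => [->|_] /=; last by rewrite addbF.
by rewrite (negPf neq) -addbA addbb.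
Qed.

Lemma bipartite_segment (A : {set T}) a b :
    (forall x y, e x y -> (x \in A) != (y \in A)) -> a <= b -> b <= len p ->
  odd (b - a) = (vertex p a \in A) (+) (vertex p b \in A).
Proof.
move=> bip; elim: b => [|b IHb] le_ab le_b.
  by rewrite (eqP (_ : a == 0)) ?addbb // -leqn0.
move: le_ab; rewrite leq_eqVlt => /orP[/eqP->|le_ab].
  by rewrite subnn addbb.
rewrite subSn // oddS IHb ?(ltnW le_b) //.
have := bip _ _ (adjacent_vertices le_b).
by case: (vertex p a \in A) (vertex p b \in A) (vertex p b.+1 \in A) => [] [] [].
Qed.

(* An even-degree edge set containing no further edge at the interior vertices
   of a segment cannot enter the segment halfway. *)
Lemma segment_all_or_nothing (C : {set {set T}}) a b :
    b <= len p -> (forall v, ~~ odd_degree C v) ->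
    (forall m E, a < m < b -> E \in C -> vertex p m \in E -> E \in edges p) ->
  segment_edges p a b \subset C \/ [disjoint segment_edges p a b & C].
Proof.
move=> le_b evenC only_p.
(* The only edges of [C] possible at an interior vertex are the two consecutive ones of the path,
   and their number is even. *)
have step m : a < m < b -> (edge m.-1 \in C) = (edge m \in C).
  move=> m_in; have in_m : 0 < m < len p by lia.
  have neq : edge m.-1 != edge m by apply/eqP => /edge_inj; lia.
  have := evenC (vertex p m); rewrite /odd_degree.
  have -> : [set E in C | vertex p m \in E] = C :&: [set edge m.-1; edge m].
    apply/setP => E; rewrite !inE; case: (boolP (E \in C)) => //= EC.
    apply/idP/orP => [vE|[]/eqP->]; last 2 first.
    - by rewrite /edge prednK ?set22 //; case/andP: in_m.
    - exact: set21.
    have /edgesP[k lt_k Ek] := only_p _ _ m_in EC vE.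
    by rewrite Ek in vE *; case: (interior_edge in_m lt_k vE) => ->; [left|right].
  have sum2 : #|C :&: [set edge m.-1; edge m]| = (edge m.-1 \in C) + (edge m \in C).
    rewrite -sum1_card big_mkcond (bigD1 (edge m.-1)) //= (bigD1 (edge m)) 1?eq_sym //=.
    rewrite big1 => [|E /andP[neq1 neq2]]; last first.
      by rewrite !inE (negPf neq1) (negPf neq2) andbF.
    by rewrite !inE !eqxx orbT !andbT addn0; do 2 case: (_ \in C).
  by rewrite sum2; do 2 case: (_ \in C).
have const k : a <= k < b -> (edge k \in C) = (edge a \in C).
  elim: k => [|k IHk] k_in; first by rewrite (eqP (_ : a == 0)) // -leqn0; lia.
  case: (ltngtP a k.+1) => [lt_a| |->] //; last by lia.
  by rewrite -IHk ?[LHS](esym (step k.+1 _)) //; lia.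
have segP E : E \in segment_edges p a b -> exists2 k, a <= k < b & E = edge k.
  rewrite inE segmentE // => /mapP[k]; rewrite mem_index_iota; by exists k.
case: (boolP (edge a \in C)) => aC; [left|right].
  by apply/subsetP => E /segP[k k_in ->]; rewrite const.
rewrite disjoint_subset; apply/subsetP => E /segP[k k_in ->].
by rewrite inE const.
Qed.

End Path.

Lemma sum_odd a b : a <= b -> \sum_(a <= k < b) odd k = b./2 - a./2.
Proof.
elim: b => [|b IHb] le_ab; first by rewrite big_geq.
move: le_ab; rewrite leq_eqVlt => /orP[/eqP->|le_ab]; first by rewrite big_geq // subnn.
by rewrite big_nat_recr //= IHb //; lia.
Qed.

(** * Structure of a decomposition and its alternating edge set *)

Section ConservativeJoin.
Variables (T : finType) (e : rel T) (r : nat) (P : 'I_r.+1 -> vorder T).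
Hypotheses (e_irr : irreflexive e) (decP : weak_nested_ear_decomposition P e).

Lemma len_gt0 i : (0 < len (P i)) = (0 < i).
Proof.
case: (posnP i) => [i0|i_gt0]; last by have /andP[] := wned_path decP i_gt0.
by rewrite (_ : i = ord0) ?(wned_vertex decP) //; apply: val_inj.
Qed.

Lemma ear_path i : 0 < len (P i) -> is_path e (P i).
Proof. by rewrite len_gt0; exact: wned_path decP i. Qed.

Lemma pendant_not_ear i : is_pendant P i -> is_ear P i = false.
Proof.
case/andP=> _ xor_prev; apply/negP => /andP[/existsP[j /andP[lt_ji]]] /andP[sj tj] _.
have prevE v : v \in vertices (P j) -> in_previous P i v.
  by move=> vj; apply/existsP; exists j; rewrite lt_ji.
by rewrite !prevE in xor_prev.
Qed.

Lemma ear_or_pendant (i : 'I_r.+1) : 0 < i -> is_ear P i = ~~ is_pendant P i.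
Proof.
case/(wned_step decP) => [ear_i|pend_i]; last by rewrite pend_i pendant_not_ear.
by rewrite ear_i; apply/esym/negP => /pendant_not_ear; rewrite ear_i.
Qed.

Lemma in_previousI (i k : 'I_r.+1) v :
  k < i -> v \in vertices (P k) -> in_previous P i v.
Proof. by move=> lt_ki vk; apply/existsP; exists k; rewrite lt_ki. Qed.

Lemma pendant_ends i v :
  is_pendant P i -> v \in vertices (P i) -> v = source (P i) \/ v = target (P i).
Proof.
case/andP=> /eqP len1 _ /verticesP[[|[|k]]]; rewrite ?target_vertex len1 //.
  by move=> _ ->; left.
by move=> _ ->; right.
Qed.

(** A vertex of an ear seen earlier is not an inner one, so it is an end and lies on the path
    holding both ends, which need not be [P i]. A pendant edge is nested in [P i] itself. *)
Lemma nested_at_vertex (i k : 'I_r.+1) v :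
    i < k -> v \in vertices (P i) -> v \in vertices (P k) ->
  exists2 j, nested_in P k j & v \in vertices (P j).
Proof.
move=> lt_ik vi vk; case/(wned_step decP): (leq_ltn_trans (leq0n i) lt_ik).
  case/andP=> /existsP[j /andP[lt_jk ends_j]] /allP not_prev.
  exists j; first by rewrite /nested_in lt_jk ends_j.
  have: v \notin inner (P k).
    by apply: contraL (in_previousI lt_ik vi) => /not_prev.
  by case/andP: ends_j => sj tj /(ends_or_inner vk)[]->.
move=> pend_k; exists i => //; rewrite /nested_in lt_ik pend_k.
by case: (pendant_ends pend_k vk) vi => -> ->; rewrite ?orbT.
Qed.

Lemma nested_exists (k : 'I_r.+1) : 0 < k -> exists j, nested_in P k j.
Proof.
move=> k_gt0; case/(wned_step decP): (k_gt0) => [/andP[/existsP[j] ej _]|pend_k].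
  by exists j; case/andP: ej => lt_jk ends_j; rewrite /nested_in lt_jk ends_j.
have /andP[_ prev] := pend_k.
have [v vk /existsP[i /andP[lt_ik vi]]] :
    exists2 v, v \in vertices (P k) & in_previous P k v.
  case: (boolP (in_previous P k (source (P k)))) prev => [sk _|_ tk].
    by exists (source (P k)); rewrite // mem_source.
  by exists (target (P k)); rewrite // mem_target.
by have [j kj _] := nested_at_vertex lt_ik vi vk; exists j.
Qed.

Lemma edges_inj i j E : E \in edges (P i) -> E \in edges (P j) -> i = j.
Proof.
move=> Ei Ej; apply/eqP; apply: contraTT Ej => /(wned_disjoint decP).
by rewrite disjoint_subset => /subsetP/(_ E Ei).
Qed.

Lemma interior_new i m :
  0 < m < len (P i) -> ~~ in_previous P i (vertex (P i) m).
Proof.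
move=> m_in; have i_gt0 : 0 < i by rewrite -len_gt0; lia.
case/(wned_step decP): i_gt0 => [/andP[_ /allP]|/andP[/eqP len1 _]]; last by lia.
by apply; exact: inner_vertex.
Qed.

(** The number [b i] of the overview. *)
Definition half_length i : nat := if is_pendant P i then 1 else (len (P i))./2.

(** The set [J] of the overview. Positions start at 0, so an ear of length l contributes exactly
    floor(l / 2) edges and its first edge is left out. *)
Definition alternating_join : {set {set T}} :=
  [set E | [exists i, (E \in edges (P i)) &&
                      (is_pendant P i || odd (index E (edges (P i))))]].

Local Notation J := alternating_join.

Lemma edge_alternating_join i k :
  k < len (P i) -> (edge (P i) k \in J) = is_pendant P i || odd k.
Proof.
move=> lt_k; have Ei := mem_edge lt_k.
have idx : index (edge (P i) k) (edges (P i)) = k.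
  by rewrite -nth_edges // index_uniq ?size_edges // (uniq_edges (ear_path (i := i))).
rewrite inE; apply/existsP/idP => [[j /andP[Ej]]|oddk].
  by rewrite (edges_inj Ej Ei) idx.
by exists i; rewrite Ei idx.
Qed.

Lemma card_segment_join i a b : a <= b -> b <= len (P i) ->
  #|segment_edges (P i) a b :&: J| =
    if is_pendant P i then b - a else b./2 - a./2.
Proof.
move=> le_ab le_b.
have -> : segment_edges (P i) a b :&: J = [set E in segment_edges (P i) a b | E \in J].
  by apply/setP => E; rewrite !inE.
rewrite (card_segment (ear_path (i := i)) (fun E => E \in J)) //.
rewrite (eq_big_nat _ _ (F2 := fun k => nat_of_bool (is_pendant P i || odd k))).
  case: ifP => _ /=; last exact: sum_odd.
  by rewrite sum_nat_const_nat muln1.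
by move=> k k_in; rewrite edge_alternating_join //; lia.
Qed.

Lemma pendant_len i : is_pendant P i -> len (P i) = 1.
Proof. by case/andP=> /eqP. Qed.

(** Along an alternating segment the numbers of edges on and off [J] differ by 0 or 1, according to
    parity; either may be the larger. On a pendant edge a segment has at most one edge. *)
Lemma segment_join_balance i a b : a <= b -> b <= len (P i) ->
  (#|segment_edges (P i) a b :&: J|.*2 <= b - a + odd (b - a)) /\
  (b - a <= #|segment_edges (P i) a b :&: J|.*2 + odd (b - a)).
Proof.
move=> le_ab le_b; rewrite card_segment_join //; case: ifP => [/pendant_len|_]; lia.
Qed.

(** A whole ear starts off [J], so here the sign of the difference is known. *)
Lemma path_join_balance i : ~~ is_pendant P i ->
  #|[set E in edges (P i)] :&: J|.*2 + odd (len (P i)) = len (P i).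
Proof.
move=> /negPf not_pend; rewrite -segment_full card_segment_join // not_pend.
lia.
Qed.

(** Each [P i] meets [J] in [half_length i] edges, and no edge is counted twice since the paths are
    edge-disjoint. *)
Lemma half_length_leq_join : \sum_i half_length i <= #|J|.
Proof.
have -> : \sum_i half_length i = \sum_i \sum_(E in J) (E \in edges (P i)).
  apply: eq_bigr => i _; transitivity #|[set E in edges (P i)] :&: J|.
    rewrite -segment_full card_segment_join // /half_length.
    by case: ifP => [/pendant_len->|_] //=; rewrite subn0.
  rewrite setIC -sum1_card big_mkcond [RHS]big_mkcond; apply: eq_bigr => E _.
  by rewrite in_setI; case: (E \in J); rewrite //= inE; case: (E \in edges _).
rewrite exchange_big -sum1_card; apply: leq_sum => E _.
case: (pickP (fun i => E \in edges (P i))) => [i Ei|none].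
  rewrite (bigD1 i) //= big1 ?Ei // => j; apply: contraNeq.
  by rewrite eqb0 negbK => /(edges_inj Ei)->.
by rewrite big1 // => i _; rewrite none.
Qed.

(** * Even-degree edge sets meet the alternating set in at most half of their edges *)

Variable A : {set T}.
Hypothesis bipA : forall x y, e x y -> (x \in A) != (y \in A).
Variables lo hi : 'I_r.+1 -> 'I_r.+1 -> nat.
Hypothesis interval : forall i j, nested_in P i j -> is_nest_interval P i j (lo i j) (hi i j).
Hypothesis laminar : forall i l j, nested_in P i j -> nested_in P l j ->
  let Ei := segment_edges (P j) (lo i j) (hi i j) in
  let El := segment_edges (P j) (lo l j) (hi l j) in
  [\/ [disjoint Ei & El], Ei \subset El | El \subset Ei].

(* If [i] has a shortest nest interval among the indices of [S] nested in [P j]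
   and no index of [S] is nested in a path after [P j], the subgraph formed by
   the paths of [S] has degree 2 inside this interval. *)
Lemma shortest_interval_private (S : {set 'I_r.+1}) (i j k : 'I_r.+1) m :
    (forall l l' : 'I_r.+1, l \in S -> nested_in P l l' -> l' <= j) ->
    (forall l, l \in S -> nested_in P l j -> hi i j - lo i j <= hi l j - lo l j) ->
    i \in S -> nested_in P i j -> k \in S -> lo i j < m < hi i j ->
    vertex (P j) m \in vertices (P k) ->
  k = j.
Proof.
move=> max_j min_i iS ij kS m_in vk.
have [le_i lei _] := interval ij.
have m_in_j : 0 < m < len (P j) by lia.
have new_v := interior_new m_in_j.
case: (ltngtP k j) => [lt_kj|lt_jk|/val_inj//].
  by rewrite (in_previousI lt_kj vk) in new_v.
have vj : vertex (P j) m \in vertices (P j) by apply: mem_vertex; lia.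
have [l kl vl] := nested_at_vertex lt_jk vj vk.
(* [l] is not after [j] by [max_j], nor before [j] because the vertex is new in [P j]. *)
have lj : l = j.
  have := max_j _ _ kS kl; rewrite leq_eqVlt => /orP[/eqP/val_inj//|lt_lj].
  by rewrite (in_previousI lt_lj vl) in new_v.
rewrite {vl}lj in kl.
have [le_k lek] := interval kl; have := min_i _ kS kl.
(* An interval reduced to a vertex would be shorter than that of [i]. *)
case: ifP => [ends_k min_k [at_ends _]|_ min_k [eq_k _]]; last by lia.
(* [P k] meets [P j] here at one of its ends, and this vertex occupies a single position in
   [P j]. *)
have m_end : m = lo k j \/ m = hi k j.
  have k_gt0 : 0 < k by exact: leq_ltn_trans lt_jk.
  have ear_k : is_ear P k.
    rewrite ear_or_pendant //; apply/negP => /andP[_].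
    by case/andP: ends_k => sk tk; rewrite !(in_previousI lt_jk).
  have not_inner : vertex (P j) m \notin inner (P k).
    case/andP: ear_k => _ /allP not_prev.
    by apply: contraL (in_previousI lt_jk vj) => /not_prev.
  have inj := interior_vertex_inj (ear_path (i := j)) m_in_j.
  case: (ends_or_inner vk not_inner) => v_end; case: at_ends => -[Ea Eb].
  - by left; apply/esym/inj; rewrite ?Ea //; lia.
  - by right; apply/esym/inj; rewrite ?Eb //; lia.
  - by right; apply/esym/inj; rewrite ?Eb //; lia.
  by left; apply/esym/inj; rewrite ?Ea //; lia.
have seg a b x : b <= len (P j) -> x < len (P j) ->
    (edge (P j) x \in segment_edges (P j) a b) = (a <= x < b).
  by move=> *; apply: mem_segment => //; exact: ear_path.
(* The interval of [k] has an end strictly inside that of [i] and is at least as long, so the two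
   cross: one edge at [m] is common, the other belongs to [i] only, and the far edge of the interval
   of [k] to [k] only. *)
case: m_end => m_end; case: (laminar ij kl).
- by move=> /disjointFr dis; have := dis (edge (P j) m); rewrite !seg; lia.
- by move=> /subsetP/(_ (edge (P j) m.-1)); rewrite !seg; lia.
- by move=> /subsetP/(_ (edge (P j) (hi k j).-1)); rewrite !seg; lia.
- by move=> /disjointFr dis; have := dis (edge (P j) m.-1); rewrite !seg; lia.
- by move=> /subsetP/(_ (edge (P j) m)); rewrite !seg; lia.
- by move=> /subsetP/(_ (edge (P j) (lo k j))); rewrite !seg; lia.
Qed.

(** Induction on the size of [S]. A subset of indices is used because the path removed need not be
    the last; [S] stays closed since nothing in it is nested in the removed path. *)
Lemma join_conservative (S : {set 'I_r.+1}) (C : {set {set T}}) :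
    (forall i j, i \in S -> nested_in P i j -> j \in S) ->
    (forall E, E \in C -> exists2 i, i \in S & E \in edges (P i)) ->
    (forall v, ~~ odd_degree C v) ->
  #|C :&: J|.*2 <= #|C|.
Proof.
have [n] := ubnP #|S|; elim: n S C => // n IHn S C le_S closedS C_S evenC.
case: (pickP (fun j => [exists i in S, nested_in P i j])) => [j0 j0P|none]; last first.
  (* Without nesting, [S] contains at most the index of [P ord0], which has no edge. *)
  rewrite (_ : C = set0) ?set0I ?cards0 //; apply/setP => E; rewrite inE.
  apply/negP => /C_S[i iS]; case: (posnP i) => [i0|/nested_exists[j ij]].
    have := len_gt0 i; rewrite i0 -size_edges lt0n => /negbT; rewrite negbK.
    by move/nilP=> ->.
  by have /existsP[] := none j; exists i; rewrite iS.
case: (@arg_maxnP _ j0 (fun j => [exists i in S, nested_in P i j]) val j0P)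
  => j /existsP[i0 i0P] max_j.
case: (@arg_minnP _ i0 (fun i => (i \in S) && nested_in P i j)
         (fun i => hi i j - lo i j) i0P) => i /andP[iS ij] min_i {i0 i0P j0 j0P}.
have {}max_j l l' : l \in S -> nested_in P l l' -> l' <= j.
  by move=> lS ll'; apply: max_j; apply/existsP; exists l; rewrite lS.
have {}min_i l : l \in S -> nested_in P l j -> hi i j - lo i j <= hi l j - lo l j.
  by move=> lS lj; apply: min_i; rewrite lS.
have lt_ji : j < i by case/andP: ij.
have jS : j \in S := closedS _ _ iS ij.
have i_gt0 : 0 < i by exact: leq_ltn_trans lt_ji.
set F := [set E in edges (P i)].
(* A later path of [S] through [v] would be nested in a path containing [v]; that path has index at
   most [j < i], so [v] would not be new. *)
have only_i v k : ~~ in_previous P i v -> v \in vertices (P i) ->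
    k \in S -> v \in vertices (P k) -> k = i.
  move=> new_v vi kS vk; case: (ltngtP k i) => [lt_ki|lt_ik|/val_inj//].
    by rewrite (in_previousI lt_ki vk) in new_v.
  have [l kl vl] := nested_at_vertex lt_ik vi vk.
  by rewrite (in_previousI (leq_ltn_trans (max_j _ _ kS kl) lt_ji) vl) in new_v.
have closedSi k l : k \in S :\ i -> nested_in P k l -> l \in S :\ i.
  rewrite !in_setD1 => /andP[_ kS] kl; rewrite (closedS _ _ kS kl) andbT.
  by apply: contraTneq (max_j _ _ kS kl) => ->; rewrite -ltnNge.
have IHSi (C' : {set {set T}}) :
    (forall E, E \in C' -> exists2 k, k \in S :\ i & E \in edges (P k)) ->
    (forall v, ~~ odd_degree C' v) -> #|C' :&: J|.*2 <= #|C'|.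
  by apply: IHn => //; move: le_S; rewrite (cardsD1 i S) iS; lia.
have F_aon : F \subset C \/ [disjoint F & C].
  rewrite /F -segment_full; apply: (segment_all_or_nothing (ear_path (i := i))) => //.
  move=> m E m_in /C_S[k kS Ek] vE.
  by rewrite -(only_i (vertex (P i) m) k) ?interior_new ?mem_vertex ?(edges_vertices Ek) //; lia.
case: F_aon => [FC|FC]; last first.
  apply: IHSi => // E EC; have [k kS Ek] := C_S E EC; exists k => //.
  rewrite in_setD1 kS andbT; apply: contraTneq EC => ki.
  by move: FC; rewrite disjoint_subset => /subsetP/(_ E); rewrite !inE -ki; exact.
(* A pendant edge in [C] would give its new vertex degree 1 in [C]. *)
case: (boolP (is_pendant P i)) => [pend_i|not_pend].
  have [v vi new_v] : exists2 v, v \in vertices (P i) & ~~ in_previous P i v.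
    case/andP: pend_i => _; case: (boolP (in_previous P i (source (P i)))).
      by move=> _ /= tnew; exists (target (P i)) => //; exact: mem_target.
    by exists (source (P i)) => //; exact: mem_source.
  have len1 := pendant_len pend_i.
  case/negP: (evenC v); rewrite /odd_degree.
  rewrite (_ : [set E in C | v \in E] = [set edge (P i) 0]) ?cards1 //.
  apply/setP => E; rewrite !inE; apply/andP/eqP => [[EC vE]|->].
    have [k kS Ek] := C_S E EC.
    move: (Ek); rewrite (only_i v k new_v vi kS (edges_vertices Ek vE)).
    by case/edgesP; rewrite len1 => -[|//] _ ->.
  split; first by apply: (subsetP FC); rewrite inE mem_edge // len1.
  rewrite !inE; case: (pendant_ends pend_i vi) => ->; first by rewrite eqxx.
  by rewrite target_vertex len1 eqxx orbT.
have ends_ij : ends_in P i j by case/andP: ij => _; rewrite (negPf not_pend) orbF.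
have [le_i lei] := interval ij; rewrite ends_ij => -[at_ends closed].
set a := lo i j in le_i lei at_ends closed *; set b := hi i j in le_i lei at_ends closed *.
set I := segment_edges (P j) a b.
have FI : [disjoint F & I].
  rewrite disjoint_subset; apply/subsetP => E; rewrite !inE => Ei.
  apply/negP => /mem_take/mem_drop/(edges_inj Ei) ij_eq.
  by rewrite ij_eq ltnn in lt_ji.
have I_aon : I \subset C \/ [disjoint I & C].
  apply: (segment_all_or_nothing (ear_path (i := j))) => //.
  move=> m E m_in /C_S[k kS Ek] vE.
  by rewrite -(shortest_interval_private max_j min_i iS ij kS m_in) ?(edges_vertices Ek).
have F_deg v : odd_degree F v = (v == source (P i)) (+) (v == target (P i)).
  rewrite /F -segment_full (odd_degree_segment e_irr (ear_path (i := i))) //.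
  by rewrite target_vertex.
have I_deg v : odd_degree I v = (v == source (P i)) (+) (v == target (P i)).
  rewrite (odd_degree_segment e_irr (ear_path (i := j))) //.
  by case: at_ends => -[-> ->] //; rewrite addbC.
have parity : odd (b - a) = odd (len (P i)).
  rewrite (bipartite_segment (ear_path (i := j)) bipA) //.
  rewrite -[len (P i)]subn0 (bipartite_segment (ear_path (i := i)) bipA) //.
  by rewrite -target_vertex; case: at_ends => -[-> ->] //; rewrite addbC.
have C'_even v : ~~ odd_degree (symd (symd C F) I) v.
  by rewrite !odd_degree_symd F_deg I_deg -addbA addbb addbF.
have {IHSi} := IHSi (symd (symd C F) I) _ C'_even.
have C'_S E : E \in symd (symd C F) I -> exists2 k, k \in S :\ i & E \in edges (P k).
  case: (boolP (E \in I)) => [/segment_sub Ej _|EI].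
    by exists j => //; rewrite in_setD1 jS andbT; apply: contraTneq lt_ji => ->; rewrite ltnn.
  rewrite !in_symd (negPf EI) addbF inE; case: (boolP (E \in edges (P i))) => EF.
    by rewrite (subsetP FC) ?inE.
  rewrite addbF => /C_S[k kS Ek]; exists k; rewrite // in_setD1 kS andbT.
  by apply: contraNneq EF => <-.
move/(_ C'_S) => {C'_S C'_even}.
have cardF : #|F| = len (P i).
  by rewrite /F -segment_full (card_segment_all (ear_path (i := i))) // subn0.
have cardI : #|I| = b - a by rewrite (card_segment_all (ear_path (i := j))).
have [balI1 balI2] := segment_join_balance le_i lei.
have balF := path_join_balance not_pend.
rewrite -/F -/I in balF balI1 balI2.
(* Inclusion-exclusion for the exchanged set, to be read with [D] equal to [setT] and to [J]. *)
have cards (D : {set {set T}}) :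
    #|symd (symd C F) I :&: D| + (#|F :&: D|).*2 + (#|C :&: I :&: D|).*2
      = #|C :&: D| + #|F :&: D| + #|I :&: D|.
  have := card_symd (symd C F :&: D) (I :&: D); rewrite -symd_setI.
  have := card_symd (C :&: D) (F :&: D); rewrite -symd_setI.
  have -> : C :&: D :&: (F :&: D) = F :&: D.
    by rewrite setIACA setIid (setIidPr FC).
  have -> : symd C F :&: D :&: (I :&: D) = C :&: I :&: D.
    rewrite setIACA setIid symd_setI; congr (_ :&: _); apply/setP => E.
    rewrite in_symd (_ : F :&: I = set0) ?inE ?addbF //.
    by apply/eqP; rewrite setI_eq0.
  by move=> cardF_D cardI_D; rewrite addnAC cardI_D addnAC cardF_D.
have cardsT := cards setT; rewrite !setIT in cardsT.
have {cards}cardsJ := cards J.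
(* Let w(X) be the number of edges of X off [J] minus the number on [J], and C' the exchanged set.
   Then w(C) = w(C') + w(F) + w(I) if [I] lies in [C], and w(C') + w(F) - w(I) otherwise; hence the
   two-sided bound on w(I). *)
case: I_aon => [IC|IC].
  rewrite (setIidPr IC) in cardsT cardsJ; lia.
have CI0 : C :&: I = set0 by apply/eqP; rewrite setIC setI_eq0.
rewrite CI0 set0I !cards0 in cardsT cardsJ; lia.
Qed.

End ConservativeJoin.

(** * Small edge sets with prescribed degree parities *)

Section SmallJoins.
Variables (T : finType) (e : rel T) (r : nat) (P : 'I_r.+1 -> vorder T).
Hypotheses (e_irr : irreflexive e) (decP : weak_nested_ear_decomposition P e).

(* If [K] uses too many edges of the last ear, adding to it the cycle formed by
   this ear and a segment of an earlier path exchanges the edges of the ear in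
   [K] with those not in [K]. *)
Lemma exchange_on_last (i : 'I_r.+1) (K : {set {set T}}) :
    (forall E, E \in K -> exists2 k : 'I_r.+1, k <= i & E \in edges (P k)) ->
  exists K1 : {set {set T}},
    [/\ forall E, E \in K1 -> exists2 k : 'I_r.+1, k <= i & E \in edges (P k),
        odd_degree K1 =1 odd_degree K
      & #|K1 :&: [set E in edges (P i)]| <= half_length P i].
Proof.
move=> K_le; set F := [set E in edges (P i)].
have cardF : #|F| = len (P i).
  by rewrite /F -segment_full (card_segment_all (ear_path decP (i := i))) // subn0.
have [small|large] := leqP #|K :&: F| (half_length P i); first by exists K.
have leKF : #|K :&: F| <= len (P i) by rewrite -cardF subset_leq_card ?subsetIr.
have i_gt0 : 0 < i by rewrite -(len_gt0 decP); lia.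
have not_pend : ~~ is_pendant P i.
  by apply/negP => pend_i; move: large; rewrite /half_length pend_i -(pendant_len pend_i); lia.
have /andP[/existsP[j /andP[lt_ji /andP[sj tj]]] _] : is_ear P i.
  by rewrite (ear_or_pendant decP).
(* Any positions in [P j] of the two ends of [P i] serve, once put in increasing order. *)
have [a [b [le_ab le_b I_deg]]] : exists a b, [/\ a <= b, b <= len (P j)
    & forall v, odd_degree (segment_edges (P j) a b) v
                = (v == source (P i)) (+) (v == target (P i))].
  have deg a b := @odd_degree_segment _ _ _ e_irr (ear_path decP (i := j)) a b.
  case/verticesP: sj => a le_a ->; case/verticesP: tj => b le_b ->.
  case/orP: (leq_total a b) => le_ab.
    by exists a, b; split=> // v; apply: deg.
  by exists b, a; split=> // v; rewrite addbC; apply: deg.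
set I := segment_edges (P j) a b in I_deg.
have FI E : E \in I -> (E \in F) = false.
  move=> /segment_sub Ej; rewrite inE; apply/negP => /(edges_inj decP Ej) ji.
  by rewrite ji ltnn in lt_ji.
exists (symd (symd K F) I); split.
- move=> E; case: (boolP (E \in I)) => [/segment_sub Ej _|EI].
    by exists j => //; apply: ltnW.
  rewrite !in_symd (negPf EI) addbF; case: (boolP (E \in K)) => [/K_le//|_ /=].
  by rewrite inE => Ei; exists i.
- move=> v; rewrite !odd_degree_symd I_deg /F -segment_full.
  rewrite (odd_degree_segment e_irr (ear_path decP (i := i))) //.
  by rewrite -target_vertex -addbA addbb addbF.
(* If more than floor(l / 2) of the l edges of the ear are in [K], at most floor(l / 2) are not. *)
have -> : symd (symd K F) I :&: F = F :\: K.
  apply/setP => E; rewrite in_setI in_setD !in_symd.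
  case: (boolP (E \in I)) => [/FI->|_]; first by rewrite !andbF.
  by do 2 case: (E \in _).
move: large (cardsID K F); rewrite /half_length (negPf not_pend) setIC cardF.
by move: #|_| #|_| => x y; lia.
Qed.

(** Induction on the number of paths: after the exchange on the last one, its few remaining edges
    are set aside, the rest is reduced, and they are added back. *)
Lemma small_join n (K : {set {set T}}) : n <= r.+1 ->
    (forall E, E \in K -> exists2 i : 'I_r.+1, i < n & E \in edges (P i)) ->
  exists K' : {set {set T}},
    [/\ forall E, E \in K' -> exists2 i : 'I_r.+1, i < n & E \in edges (P i),
        odd_degree K' =1 odd_degree K
      & #|K'| <= \sum_(i < r.+1 | i < n) half_length P i].
Proof.
elim: n K => [|n IHn] K le_n K_lt.
  exists K; split=> //; rewrite (_ : K = set0) ?cards0 //.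
  by apply/setP => E; rewrite inE; apply/negP => /K_lt[].
pose i := Ordinal le_n; set F := [set E in edges (P i)].
have [K1 [K1_lt K1_deg K1_F]] := @exchange_on_last i K K_lt.
(* This is [K1] without [F], written as a symmetric difference so that degree parities add and
   adding [K1 :&: F] again restores them. *)
have [|E|K2 [K2_lt K2_deg K2_le]] := IHn (symd K1 (K1 :&: F)); first exact: ltnW.
  rewrite in_symd in_setI; case: (boolP (E \in K1)) => //= /K1_lt[k le_k Ek] EF.
  exists k => //; rewrite ltn_neqAle le_k andbT; apply: contra EF => /eqP kn.
  by rewrite inE (_ : i = k) //; apply: val_inj.
exists (symd K2 (K1 :&: F)); split.
- move=> E; rewrite in_symd; case: (boolP (E \in K2)) => [/K2_lt[k lt_k Ek] _|_ /=].
    by exists k => //; apply: ltnW.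
  by case/setIP=> /K1_lt.
- by move=> v; rewrite odd_degree_symd K2_deg -odd_degree_symd symdK K1_deg.
apply: leq_trans (leq_card_symd _ _) _; rewrite (bigD1 i) //= addnC leq_add //.
apply: leq_trans K2_le _; rewrite leq_eqVlt; apply/orP; left; apply/eqP.
by apply: eq_bigl => k; rewrite ltnS ltn_neqAle andbC.
Qed.

(** * Counting vertices *)

Definition new_vertices i : {set T} :=
  [set v in vertices (P i) | ~~ in_previous P i v].

(** An ear of length l adds l - 1 vertices, and 2 floor(l / 2) is l - 1, plus 1 if l is even. A
    pendant edge gives 2 = 1 + 1, and the initial vertex gives 0 + 1 = 1. *)
Lemma card_new_vertices (i : 'I_r.+1) :
  (half_length P i).*2 + (i == ord0) =
    (is_ear P i && ~~ odd (len (P i))) + is_pendant P i + #|new_vertices i|.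
Proof.
case: (posnP i) => [/(@val_inj _ _ _ _ ord0)->|i_gt0].
  have len0 := wned_vertex decP.
  have not_pend : is_pendant P ord0 = false by rewrite /is_pendant len0.
  have not_ear : is_ear P ord0 = false.
    by apply/negP => /andP[/existsP[j]].
  rewrite /half_length not_pend not_ear len0 /=.
  rewrite (_ : new_vertices ord0 = [set source (P ord0)]) ?cards1 //.
  apply/setP => v; rewrite !inE; apply/andP/eqP => [[]|->].
    by case/verticesP=> k; rewrite len0 leqn0 => /eqP->.
  by split; [exact: mem_source | apply/existsP => -[]].
rewrite (_ : i == ord0 = false) ?addn0; last by apply: gtn_eqF.
rewrite (ear_or_pendant decP) // /half_length.
have [pend_i|not_pend] /= := boolP (is_pendant P i).
  have [u ui newu] : exists2 u, u \in vertices (P i) & new_vertices i = [set u].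
    case/andP: (pend_i) => _.
    have ends v := pendant_ends (v := v) pend_i.
    case: (boolP (in_previous P i (source (P i)))) => [old_s new_t|new_s old_t].
      exists (target (P i)); first exact: mem_target.
      apply/setP => v; rewrite !inE; apply/andP/eqP => [[/ends[->|->//]]|->].
        by rewrite old_s.
      by split; [exact: mem_target | exact: new_t].
    exists (source (P i)); first exact: mem_source.
    apply/setP => v; rewrite !inE; apply/andP/eqP => [[/ends[->//|->]]|->].
      by move/negP; case; exact: old_t.
    by split; [exact: mem_source | exact: new_s].
  by rewrite newu cards1.
have /andP[/existsP[j /andP[lt_ji /andP[sj tj]]] /allP new_inner] : is_ear P i.
  by rewrite (ear_or_pendant decP).
have -> : new_vertices i = [set v in inner (P i)].
  apply/setP => v; rewrite !inE; apply/andP/idP => [[vi new_v]|v_in].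
    apply: contraNT new_v => /(ends_or_inner vi)[]->; exact: in_previousI lt_ji _.
  split; last exact: new_inner.
  by apply: mem_belast; apply: mem_behead.
have /and5P[len_gt _ _ uniq_hd _] := wned_path decP i_gt0.
have uniq_inner : uniq (inner (P i)) by rewrite /inner -drop1 drop_uniq.
rewrite cardsE (card_uniqP uniq_inner) size_behead size_belast -/(len (P i)).
lia.
Qed.

Lemma double_half_lengths : no_isolated e ->
  (\sum_i half_length P i).*2.+1 = num_even_ears P + num_pendants P + #|T|.
Proof.
move=> no_iso.
have cardT : #|T| = \sum_i #|new_vertices i|.
  transitivity (\sum_(v : T) \sum_i (v \in new_vertices i)); last first.
    rewrite exchange_big; apply: eq_bigr => i _.
    by rewrite -sum1_card [RHS]big_mkcond; apply: eq_bigr => v _; case: (v \in _).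
  rewrite -sum1_card; apply: eq_bigr => v _.
  have [y vy] := no_iso v.
  have : [set v; y] \in edge_set e by apply/imset2P; exists v y; rewrite ?inE.
  rewrite -(wned_cover decP) => /bigcupP[i0 _]; rewrite inE => Ei.
  have vi0 : v \in vertices (P i0) by rewrite (edges_vertices Ei) ?set21.
  (* With no isolated vertices every vertex lies on some path; it is new exactly in the first such
     path. *)
  case: (@arg_minnP _ i0 (fun i => v \in vertices (P i)) val vi0) => i vi min_i.
  have new_v : v \in new_vertices i.
    rewrite inE vi; apply/existsP => -[j /andP[lt_ji /min_i]].
    by rewrite leqNgt lt_ji.
  rewrite (bigD1 i) //= new_v big1 // => k neq_ki; apply/eqP; rewrite eqb0 inE.
  rewrite negb_and negbK; case: (ltngtP k i) => [lt_ki|lt_ik|/val_inj ki].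
  - by apply/orP; left; apply: contraL lt_ki => /min_i; rewrite -leqNgt.
  - by rewrite (in_previousI lt_ik vi) orbT.
  by rewrite ki eqxx in neq_ki.
have cardI (f : pred 'I_r.+1) : #|[set i | f i]| = \sum_i f i.
  by rewrite -sum1_card big_mkcond; apply: eq_bigr => i _; rewrite inE; case: (f i).
rewrite /num_even_ears /num_pendants !cardI cardT -!big_split /=.
rewrite -(eq_bigr _ (fun i _ => card_new_vertices i)) big_split /=.
rewrite -mul2n big_distrr /=.
have -> : \sum_(i < r.+1) (i == ord0) = 1.
  by rewrite (bigD1 ord0) //= big1 // => i /negPf->.
by rewrite addn1; congr _.+1; apply: eq_bigr => i _; rewrite mul2n.
Qed.

End SmallJoins.

(** * Comparison of two decompositions *)

Lemma half_lengths_leq (T : finType) (e : rel T) (r s : nat)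
    (P : 'I_r.+1 -> vorder T) (Q : 'I_s.+1 -> vorder T) :
    irreflexive e -> bipartite e -> weak_nested_ear_decomposition P e ->
    weak_nested_ear_decomposition Q e ->
  \sum_i half_length P i <= \sum_i half_length Q i.
Proof.
move=> e_irr [A bipA] decP decQ; have [lo [hi [interval laminar]]] := wned_nesting decP.
have coverP n (R : 'I_n.+1 -> vorder T) : weak_nested_ear_decomposition R e ->
    forall E, reflect (exists i, E \in edges (R i)) (E \in edge_set e).
  move=> decR E; rewrite -(wned_cover decR).
  by apply: (iffP bigcupP) => [[i _ Ei]|[i Ei]]; exists i => //; move: Ei; rewrite inE.
set J := alternating_join P.
have J_sub E : E \in J -> E \in edge_set e.
  by rewrite inE => /existsP[i /andP[Ei _]]; apply/(coverP _ _ decP); exists i.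
(* [J] comes from [P], and [Q] provides a small [J'] with the same degree parities; what remains is
   that [J] has at most as many edges as [J']. *)
have [E /J_sub/(coverP _ _ decQ)[i Ei]|J' [J'_sub J'_deg J'_le]] :=
    small_join e_irr decQ (K := J) (leqnn _).
  by exists i.
have J'_e E : E \in J' -> E \in edge_set e.
  by move=> /J'_sub[i _ Ei]; apply/(coverP _ _ decQ); exists i.
apply: leq_trans (half_length_leq_join decP) _.
have -> : \sum_i half_length Q i = \sum_(i < s.+1 | i < s.+1) half_length Q i.
  by apply: eq_bigl => i; rewrite ltn_ord.
apply: leq_trans J'_le; rewrite -/J.
(* The symmetric difference has even degrees, so at most half of it, namely [J :\: J'], lies in
   [J]. *)
have : #|symd J J' :&: J|.*2 <= #|symd J J'|.
  apply: (join_conservative e_irr decP bipA interval laminar (S := setT)) => [i j||].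
  - by rewrite !inE.
  - move=> E; rewrite in_symd => EJ; have Ee : E \in edge_set e.
      by case: (boolP (E \in J)) EJ => [/J_sub//|_ /J'_e].
    by have /(coverP _ _ decP)[i Ei] := Ee; exists i.
  by move=> v; rewrite odd_degree_symd J'_deg addbb.
have -> : symd J J' :&: J = J :\: J'.
  by apply/setP => E; rewrite in_setI in_setD in_symd; do 2 case: (E \in _).
move: (card_symd J J') (cardsID J' J).
by move: #|_| #|_| #|_| #|_| #|_| => x y z t u; lia.
Qed.

Theorem corollary4p5 (T : finType) (e : rel T)
    (Gsimple : simple_graph e) (Gisol : no_isolated e) (Gbip : bipartite e)
    (r : nat) (P : 'I_r.+1 -> vorder T) (s : nat) (Q : 'I_s.+1 -> vorder T)
    (decP : weak_nested_ear_decomposition P e)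
    (decQ : weak_nested_ear_decomposition Q e) :
  num_even_ears P + num_pendants P = num_even_ears Q + num_pendants Q.
Proof.
have e_irr : irreflexive e by case: Gsimple.
have eq_half : \sum_i half_length P i = \sum_i half_length Q i.
  by apply/eqP; rewrite eqn_leq !(half_lengths_leq e_irr Gbip).
apply: (@addIn #|T|).
by rewrite -(double_half_lengths decP) // -(double_half_lengths decQ) // eq_half.
Qed.
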